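(* Let $f\in\mathcal S^1_{\mu,L}$ with $0<\mu\leqslant L<\infty$, and let $x^*$ be its minimizer. Let $x_0,v_0\in V$ and, for $k\geqslant 0$ and step sizes $\alpha_k>0$, let $(y_k,v_{k+1},x_{k+1})$ be defined by $$\begin{cases} y_k=x_k+\alpha_k(v_k-y_k),\\ v_{k+1}=v_k+\alpha_k(y_k-v_{k+1})-\dfrac{\alpha_k}{\mu}\nabla f(y_k),\\ x_{k+1}=y_k-\dfrac1L\nabla f(y_k).\end{cases}$$ Set $\mathcal L_k=f(x_k)-f(x^* )+\frac\mu2\|v_k-x^*\|^2$. If $L\alpha_k^2\leqslant\mu(1+\alpha_k)$, then $$\mathcal L_{k+1}\leqslant\frac1{1+\alpha_k}\mathcal L_k .$$ In particular, for the choice $\alpha_k=\sqrt{\mu/L}$, or for the choice $\alpha_k=\dfrac{\mu+\sqrt{\mu^2+4L\mu}}{2L}$, one has $$\mathcal L_{k+1}\leqslant\frac1{1+\sqrt{\mu/L}}\,\mathcal L_k .$$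
   Context: $V$ is a real Hilbert space with norm $\|\cdot\|$, identified with its dual by the Riesz map (so gradients are elements of $V$); $\langle\cdot,\cdot\rangle$ is the pairing. $\mathcal S^1_{\mu,L}$ is the set of convex continuously differentiable $f:V\to\mathbb R$ with $\mu\|x-y\|^2\leqslant\langle\nabla f(x)-\nabla f(y),x-y\rangle\leqslant L\|x-y\|^2$ for all $x,y\in V$. *)

(* Defs.v *)
From HB Require Import structures.
From mathcomp Require Import all_boot all_order all_algebra.
From mathcomp Require Import all_classical all_reals all_analysis.

Set Implicit Arguments.
Unset Strict Implicit.
Unset Printing Implicit Defensive.

Import Order.TTheory GRing.Theory Num.Theory.
Import numFieldNormedType.Exports.

Local Open Scope classical_set_scope.
Local Open Scope ring_scope.

(* A real Hilbert space is a complete normed module V over a realType together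
   with a positive definite symmetric bilinear form whose square root is the
   norm of V. *)
Definition induces_norm (R : realType) (V : completeNormedModType R)
    (dot : {dot V for idfun}) : Prop :=
  forall u : V, `|u| = Num.sqrt (dot u u).

(* The Riesz representative of the differential of f at x. By the Riesz theorem
   it exists and is unique when f is differentiable at x; otherwise the value is
   junk. *)
Definition grad (R : realType) (V : completeNormedModType R)
    (dot : {dot V for idfun}) (f : V -> R) (x : V) : V :=
  get [set g : V | forall h : V, 'd f x h = dot g h].

(* The class S^1_{mu,L}. Under the Riesz isometry, continuity of the gradient
   as a map V -> V is continuity of the differential into the dual of V. *)
Definition S1 (R : realType) (V : completeNormedModType R)
    (dot : {dot V for idfun}) (mu L : R) : set (V -> R) :=
  [set f | [/\ convex_function [set: V] f,
     forall x : V, differentiable f x,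
     continuous (grad dot f) &
     forall x y : V,
       mu * `|x - y| ^+ 2 <= dot (grad dot f x - grad dot f y) (x - y) /\
       dot (grad dot f x - grad dot f y) (x - y) <= L * `|x - y| ^+ 2]].

Definition lyapunov (R : realType) (V : completeNormedModType R)
    (f : V -> R) (mu : R) (xstar : V) (x v : nat -> V) (k : nat) : R :=
  f (x k) - f xstar + mu / 2 * `|v k - xstar| ^+ 2.

(* Main.v *)
(* Put a = alpha_k, p = y - x*, w = v_k - x*, g = grad f (y). Adding the descent
   inequality f (x_{k+1}) <= f (y) - |g|^2 / (2 L), the tangent inequality at y
   evaluated at x_k, and a times the strong convexity inequality at y evaluated
   at x*, the difference L_k - (1 + a) L_{k+1} is bounded below by
     a / (2 mu (1 + a)) |mu (w - p) - a g|^2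
       + ((1 + a) / (2 L) - a^2 / (2 mu)) |g|^2,
   and the last coefficient is nonnegative exactly when L a^2 <= mu (1 + a). For
   the two special step sizes, L a^2 is mu, resp. mu (1 + a); in both cases
   a >= sqrt (mu / L). *)
Require Import Defs.
From mathcomp Require Import all_boot all_order all_algebra.
From mathcomp Require Import all_classical all_reals all_analysis.
From mathcomp Require Import ring lra.

Import Order.TTheory GRing.Theory Num.Theory.
Import numFieldNormedType.Exports.

Local Open Scope classical_set_scope.
Local Open Scope ring_scope.

(** * Inner product calculus and Riesz representation *)

Section DotProduct.
Context {R : realType} {V : completeNormedModType R}.
Context (dot : {dot V for idfun}).

Lemma dotC (u v : V) : dot u v = dot v u.
Proof. by rewrite hermC expr0 mul1r. Qed.

Lemma dotDl (u v w : V) : dot (u + v) w = dot u w + dot v w.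
Proof. exact: linearDl. Qed.

Lemma dotDr (u v w : V) : dot u (v + w) = dot u v + dot u w.
Proof. exact: linearDr. Qed.

Lemma dotNl (u v : V) : dot (- u) v = - dot u v.
Proof. exact: linearNl. Qed.

Lemma dotNr (u v : V) : dot u (- v) = - dot u v.
Proof. exact: linearNr. Qed.

Lemma dotZl (a : R) (u v : V) : dot (a *: u) v = a * dot u v.
Proof. exact: linearZl_LR. Qed.

Lemma dotZr (a : R) (u v : V) : dot u (a *: v) = a * dot u v.
Proof. exact: linearZr_LR. Qed.

Lemma dot_ge0 (u : V) : 0 <= dot u u.
Proof.
have [->|u0] := eqVneq u 0; first by rewrite linear0l.
exact/ltW/neq0_dnorm_gt0.
Qed.

Definition dotE := (dotDl, dotDr, dotNl, dotNr, dotZl, dotZr).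

Hypothesis dot_norm : induces_norm dot.

Lemma sqr_normE (u : V) : `|u| ^+ 2 = dot u u.
Proof. by rewrite dot_norm sqr_sqrtr ?dot_ge0. Qed.

(* The representative is the minimizer of [q u = |u|^2 - 2 l u]; minimizing
   sequences are Cauchy by the parallelogram identity. *)
Lemma riesz (l : {linear V -> R}) : continuous l ->
  exists g : V, forall h, l h = dot g h.
Proof.
move=> lc.
have lZ a u : l (a *: u) = a * l u by exact: linearZ.
have lD u v : l (u + v) = l u + l v by exact: linearD.
have [C [C0 lC]] : exists C, 0 < C /\ forall u, `|l u| <= C * `|u|.
  have /linear_boundedP/pinfty_ex_gt0[C C0 lC] : bounded_near l (nbhs 0).
    exact/linear_bounded_continuous.
  by exists C.
pose q u := dot u u - 2 * l u.
pose E := range q.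
have Eb : has_inf E.
  split; first by exists (q 0), 0.
  (* From [|l u| <= C |u|] follows [q u >= (|u| - C)^2 - C^2]. *)
  exists (- C ^+ 2) => _ [u _ <-]; rewrite /q -sqr_normE.
  have := lC u; have := ler_norm (l u); have := sqr_ge0 (`|u| - C).
  rewrite sqrrB mulr2n; lra.
pose m := inf E.
have qm u : m <= q u by apply: ge_inf; [exact: Eb.2|exists u].
have /choice[u qu] : forall n : nat, exists u, q u < m + n.+1%:R^-1.
  move=> n; have [|_ [u _ <-] qu] := @inf_adherent _ E n.+1%:R^-1 _ Eb.
    by rewrite invr_gt0 ltr0n.
  by exists u.
have par v w : `|v - w| ^+ 2 = 2 * q v + 2 * q w - 4 * q (2^-1 *: (v + w)).
  rewrite sqr_normE /q lZ lD !dotE (dotC w v).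
  lra.
(* In [par] the midpoint value is at least [m], while [q (u k)] and [q (u n)] are below
   [m + 1/(k+1)]. *)
have d2 n k : (k <= n)%N -> `|u k - u n| ^+ 2 <= 4 * k.+1%:R^-1.
  move=> kn; rewrite par.
  have := qm (2^-1 *: (u k + u n)); have := qu k; have := qu n.
  have : n.+1%:R^-1 <= k.+1%:R^-1 :> R by rewrite lef_pV2 ?posrE ?ltr0n ?ler_nat.
  move: (q _) (q _) (q _) k.+1%:R^-1 n.+1%:R^-1 => *; lra.
have /cauchy_cvgP/cvg_ex[g ug] : cauchy (u @ \oo).
  apply: cauchy_exP => e e0.
  have [k ke] : exists k : nat, 4 * k.+1%:R^-1 < e ^+ 2 :> R.
    have e40 : 0 < e ^+ 2 / 4 by rewrite divr_gt0 ?exprn_gt0.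
    have [k _ /(_ k (leqnn k)) /= ke] := near_infty_natSinv_lt (PosNum e40).
    by exists k; move: ke; rewrite ltr_pdivlMr// mulrC.
  exists (u k); exists k => // n /= kn.
  rewrite -ball_normE /= -(ltr_pXn2r (n := 2)) ?nnegrE ?normr_ge0 ?(ltW e0)//.
  exact: le_lt_trans (d2 _ _ kn) ke.
have qg : q g <= m.
  have uq : q (u n) @[n --> \oo] --> q g.
    rewrite /q; apply: cvgB.
      under eq_fun do rewrite -sqr_normE expr2.
      by rewrite -sqr_normE expr2; apply: cvgM; exact: cvg_norm.
    by apply: cvgM; [exact: cvg_cst|apply: cvg_comp ug _; exact: lc].
  have mh : m + n.+1%:R^-1 @[n --> \oo] --> m + 0.
    by apply: cvgD; [exact: cvg_cst|exact: cvg_harmonic].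
  rewrite -[m]addr0; apply: (ler_cvg_to uq mh).
  by near=> n; exact/ltW.
exists g => h.
(* Perturb [g] by [- t h] with [t = d / s]; the 1 in [s] avoids a case split on [h = 0]. The change
   of [q] is [- t^2 (2 + |h|^2)], so minimality forces [t = 0], hence [d = 0]. *)
pose d := dot g h - l h.
pose s := 1 + dot h h.
have s0 : 0 < s by rewrite ltr_pwDl ?dot_ge0.
have : q g <= q (g + (- (d / s)) *: h) by exact: le_trans (qm _).
rewrite -subr_ge0 /q lD lZ !dotE (dotC h g).
pose t := d / s.
have dE : dot g h = l h + t * s by rewrite /t divfK ?gt_eqF// /d; lra.
rewrite -/t dE /s => tge0.
have th0 := mulr_ge0 (sqr_ge0 t) (dot_ge0 h).
have t0 : t ^+ 2 <= 0 by lra.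
have /eqP : t ^+ 2 = 0 by apply/eqP; rewrite eq_le t0 sqr_ge0.
by rewrite sqrf_eq0 => /eqP ->; rewrite mul0r addr0.
Unshelve. all: by end_near. Qed.

(** * Gradients and calculus along lines *)

Section Gradient.
Context (f : V -> R) (df : forall x, differentiable f x).

(** The differential is continuous, so [riesz] supplies a representative and [get] does not return
    its default value. *)
Lemma gradP (x h : V) : 'd f x h = dot (grad dot f x) h.
Proof.
have /getPex : exists g, [set g : V | forall h : V, 'd f x h = dot g h] g.
  exact/riesz/diff_continuous.
exact.
Qed.

Lemma is_derive_line (y h : V) (t : R) :
  is_derive t 1 (fun s : R => f (y + s *: h)) (dot (grad dot f (y + t *: h)) h).
Proof.
have dl : is_diff t (fun s : R => y + s *: h) ( *:%R^~ h).
  by apply: is_diff_eq; rewrite add0r.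
have dfl : is_diff t (f \o (fun s : R => y + s *: h))
    ('d f (y + t *: h) \o *:%R^~ h).
  by apply: is_diff_comp; exact: differentiableP.
apply: DeriveDef.
  exact/diff_derivable.
by rewrite deriveE// (diff_val (f := _ \o _))/= scale1r gradP.
Qed.

End Gradient.

End DotProduct.

(** Mean value theorem on [0, 1] for [phi] minus the quadratic with derivative [dphi 0 + K t]. The
    intermediate point is positive, so the bound is asked only for [0 < t], which lets callers
    divide by [t]. *)
Lemma le_quadratic (R : realType) (phi dphi : R -> R) (K : R) :
  (forall t : R, is_derive t 1 phi (dphi t)) ->
  (forall t, 0 < t -> dphi t <= dphi 0 + K * t) ->
  phi 1 <= phi 0 + dphi 0 + K / 2.
Proof.
move=> phiP dphi_le.
pose psi (t : R) := phi t - (dphi 0 * t + K / 2 * t ^+ 2).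
have psiP (t : R) : is_derive t 1 psi (dphi t - (dphi 0 + K * t)).
  by apply: is_derive_eq; rewrite /GRing.scale /=; lra.
have psi_cont : {within `[0, 1], continuous psi}.
  apply: continuous_subspaceT => x; apply: differentiable_continuous.
  exact/derivable1_diffP/ex_derive.
have [c + psi01] := @MVT _ psi _ 0 1 ltr01 (fun x _ => psiP x) psi_cont.
rewrite in_itv /= => /andP[c0 _].
have := dphi_le _ c0; move: psi01; rewrite /psi; lra.
Qed.

(** * Quadratic bounds on [f] and one step of the scheme *)

Section Descent.
Context {R : realType} {V : completeNormedModType R}.
Context (dot : {dot V for idfun}) (dot_norm : induces_norm dot).
Context (mu L : R) (f : V -> R) (f_S1 : S1 dot mu L f).

(** The gradient bound between [y + t h] and [y], divided by [t], is the hypothesis of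
    [le_quadratic] with [K = L |h|^2]. *)
Lemma S1_upper (y h : V) :
  f (y + h) <= f y + dot (grad dot f y) h + L / 2 * dot h h.
Proof.
have [_ df _ gradL] := f_S1.
have := @le_quadratic R (fun t => f (y + t *: h))
  (fun t => dot (grad dot f (y + t *: h)) h) (L * dot h h)
  (fun t => is_derive_line dot dot_norm f df y h t).
rewrite scale1r scale0r addr0 [L / 2 * _]mulrAC; apply => t t0.
have [_] := gradL (y + t *: h) y; rewrite (addrC y) addrK.
move: (grad _ _ _) (grad _ _ _) => g1 g0.
rewrite (sqr_normE dot dot_norm) !dotE => tL.
rewrite -(ler_pM2l t0); lra.
Qed.

(** The same argument for [- f], with [K = - mu |h|^2]. *)
Lemma S1_lower (y h : V) :
  f y + dot (grad dot f y) h + mu / 2 * dot h h <= f (y + h).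
Proof.
have [_ df _ gradL] := f_S1.
have := @le_quadratic R (fun t => - f (y + t *: h))
  (fun t => - dot (grad dot f (y + t *: h)) h) (- mu * dot h h).
rewrite scale1r scale0r addr0 => H.
suff : - f (y + h) <= - f y - dot (grad dot f y) h + - mu * dot h h / 2 by lra.
apply: H => [t|t t0].
  exact: is_deriveN (is_derive_line dot dot_norm f df y h t).
have [+ _] := gradL (y + t *: h) y; rewrite (addrC y) addrK.
move: (grad _ _ _) (grad _ _ _) => g1 g0.
rewrite (sqr_normE dot dot_norm) !dotE => tL.
rewrite -(ler_pM2l t0); lra.
Qed.

Hypotheses (mu_gt0 : 0 < mu) (L_gt0 : 0 < L).

Lemma lyapunov_step (xs x v y x' v' : V) (a : R) :
  0 < a -> L * a ^+ 2 <= mu * (1 + a) ->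
  y = x + a *: (v - y) ->
  v' = v + a *: (y - v') - (a / mu) *: grad dot f y ->
  x' = y - (1 / L) *: grad dot f y ->
  (1 + a) * (f x' - f xs + mu / 2 * `|v' - xs| ^+ 2)
    <= f x - f xs + mu / 2 * `|v - xs| ^+ 2.
Proof.
move=> a0 aL yE v'E x'E.
pose g := grad dot f y; pose p := y - xs; pose w := v - xs.
have a1 : 0 < 1 + a by rewrite addr_gt0.
have xE : x = y + (- a) *: (w - p).
  rewrite /w /p opprB addrA subrK scaleNr.
  by apply/eqP; rewrite eq_sym subr_eq {1}yE.
have xsE : xs = y - p by rewrite /p opprB addrC subrK.
(* The implicit update solved for [v'], recentred at [xs]. *)
have w'E : v' - xs = (1 + a)^-1 *: (w + a *: p - (a / mu) *: g).
  apply: (scalerI (lt0r_neq0 a1)); rewrite scalerA divff ?gt_eqF// scale1r.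
  have -> : a *: p = a *: (y - v') + a *: (v' - xs).
    by rewrite -scalerDr addrA subrK.
  by rewrite scalerDl scale1r {1}v'E /w -/g [LHS](ACl (1*4*(2*5)*3)%AC)/=.
have fx' : f x' <= f y - dot g g / (2 * L).
  have := S1_upper y (- ((1 / L) *: g)); rewrite -x'E !dotE => /le_trans; apply.
  rewrite -/g [leLHS](_ : _ = f y - dot g g / (2 * L))//; field.
  exact: lt0r_neq0.
(* The nonnegative quadratic term of [S1_lower] is dropped, leaving the tangent inequality. *)
have fx : f y - a * dot g (w - p) <= f x.
  have := S1_lower y ((- a) *: (w - p)); rewrite -xE -/g !dotZr dotZl.
  have := mulr_ge0 (mulr_ge0 (ltW mu_gt0) (sqr_ge0 a)) (dot_ge0 dot (w - p)).
  lra.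
have fxs : f y - dot g p + mu / 2 * dot p p <= f xs.
  by have := S1_lower y (- p); rewrite -xsE !dotE opprK.
have wE : v - xs = w by [].
clearbody g p w.
have sq_ge0 := dot_ge0 dot (mu *: (w - p) - a *: g).
have gg_ge0 := dot_ge0 dot g.
(* The step-size condition enters here, as the sign of a numerator. *)
have muL_ge0 : 0 <= (1 + a) / (2 * L) - a ^+ 2 / (2 * mu).
  have -> : (1 + a) / (2 * L) - a ^+ 2 / (2 * mu) =
      (mu * (1 + a) - L * a ^+ 2) / (2 * L * mu).
    by field; rewrite !lt0r_neq0.
  by rewrite divr_ge0 ?subr_ge0// !mulr_ge0// ltW.
(* An exact identity: the slacks of [fx], [fx'] and [fxs] with weights [1], [1 + a] and [a], then a
   square and a multiple of [|g|^2]. *)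
have key : f x - f xs + mu / 2 * dot w w - (1 + a) *
    (f x' - f xs + mu / 2 * dot (v' - xs) (v' - xs)) =
    (f x - (f y - a * dot g (w - p))) +
    (1 + a) * (f y - dot g g / (2 * L) - f x') +
    a * (f xs - (f y - dot g p + mu / 2 * dot p p)) +
    a / (2 * mu * (1 + a)) *
      dot (mu *: (w - p) - a *: g) (mu *: (w - p) - a *: g) +
    ((1 + a) / (2 * L) - a ^+ 2 / (2 * mu)) * dot g g.
  rewrite w'E !dotE (dotC dot p w) (dotC dot w g) (dotC dot p g).
  by field; rewrite !lt0r_neq0.
rewrite !(sqr_normE dot dot_norm) wE -subr_ge0 key.
have a_ge0 := ltW a0; have a1_ge0 := ltW a1; have mu_ge0 := ltW mu_gt0.
rewrite -subr_ge0 in fx'; rewrite -subr_ge0 in fxs.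
do 4![apply: addr_ge0; last by rewrite !mulr_ge0// invr_ge0 !mulr_ge0].
by rewrite subr_ge0.
Qed.

End Descent.

Theorem theorem6p1 (R : realType) (V : completeNormedModType R)
    (dot : {dot V for idfun}) (dot_norm : induces_norm dot)
    (mu L : R) (mu_gt0 : 0 < mu) (mu_le_L : mu <= L)
    (f : V -> R) (f_S1 : S1 dot mu L f)
    (xstar : V) (xstar_min : forall z : V, f xstar <= f z)
    (x0 v0 : V) (alpha : nat -> R) (alpha_gt0 : forall k, 0 < alpha k)
    (x y v : nat -> V) (x_0 : x 0%N = x0) (v_0 : v 0%N = v0)
    (y_step : forall k, y k = x k + alpha k *: (v k - y k))
    (v_step : forall k, v k.+1 =
       v k + alpha k *: (y k - v k.+1) - (alpha k / mu) *: grad dot f (y k))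
    (x_step : forall k, x k.+1 = y k - (1 / L) *: grad dot f (y k)) :
  (forall k, L * alpha k ^+ 2 <= mu * (1 + alpha k) ->
     lyapunov f mu xstar x v k.+1
       <= 1 / (1 + alpha k) * lyapunov f mu xstar x v k) /\
  (forall k,
     alpha k = Num.sqrt (mu / L) \/
     alpha k = (mu + Num.sqrt (mu ^+ 2 + 4 * L * mu)) / (2 * L) ->
     lyapunov f mu xstar x v k.+1
       <= 1 / (1 + Num.sqrt (mu / L)) * lyapunov f mu xstar x v k).
Proof.
have L_gt0 : 0 < L by exact: lt_le_trans mu_le_L.
have step k : L * alpha k ^+ 2 <= mu * (1 + alpha k) ->
    (1 + alpha k) * lyapunov f mu xstar x v k.+1 <= lyapunov f mu xstar x v k.
  move=> aL.
  exact: (lyapunov_step dot dot_norm mu L f f_S1 mu_gt0 L_gt0 xstar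
    (x k) (v k) (y k) (x k.+1) (v k.+1) (alpha k)).
have a1 k : 0 < 1 + alpha k by rewrite addr_gt0.
split=> k; first by move=> /step; rewrite div1r ler_pdivlMl.
have muL_gt0 : 0 < mu / L by rewrite divr_gt0.
have s_gt0 : 0 < Num.sqrt (mu / L) by rewrite sqrtr_gt0.
have Ls2 : L * Num.sqrt (mu / L) ^+ 2 = mu.
  by rewrite sqr_sqrtr ?ltW// mulrC divfK ?lt0r_neq0.
(* Nonnegativity allows the factor [1 + alpha k] to be lowered to [1 + sqrt (mu / L)]. *)
have lyap_ge0 : 0 <= lyapunov f mu xstar x v k.+1.
  by rewrite /lyapunov addr_ge0 ?subr_ge0// mulr_ge0 ?sqr_ge0// divr_ge0// ltW.
move=> alphaE.
suff [aL sa] : L * alpha k ^+ 2 <= mu * (1 + alpha k) /\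
    Num.sqrt (mu / L) <= alpha k.
  rewrite div1r ler_pdivlMl ?addr_gt0//; apply: le_trans (step k aL).
  by rewrite ler_wpM2r// lerD2l.
case: alphaE => aE.
  by rewrite aE lexx Ls2; split=> //; rewrite ler_peMr ?ltW// ltrDl.
(* The second choice is the positive root of this quadratic equation. *)
have aL : L * alpha k ^+ 2 = mu * (1 + alpha k).
  have D_ge0 : 0 <= mu ^+ 2 + 4 * L * mu.
    by rewrite addr_ge0 ?sqr_ge0// !mulr_ge0// ltW.
  have := sqr_sqrtr D_ge0; rewrite aE.
  move: (Num.sqrt (_ + _)) => r r2.
  have -> : L * ((mu + r) / (2 * L)) ^+ 2 =
      (mu ^+ 2 + 2 * mu * r + r ^+ 2) / (4 * L).
    by field; rewrite lt0r_neq0.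
  by rewrite r2; field; rewrite lt0r_neq0.
split; first by rewrite aL.
(* Compare squares times [L]: [mu] against [mu (1 + alpha k)]. *)
rewrite -(ler_pXn2r (n := 2)) ?nnegrE ?(ltW s_gt0) ?(ltW (alpha_gt0 k))//.
rewrite -(ler_pM2l L_gt0) Ls2 aL ler_peMr ?(ltW mu_gt0)//.
by rewrite lerDl ltW.
Qed.
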